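(* Let $\mathcal T_p$ (parent) and $\mathcal T_c$ (child) be rooted binary trees with HS profiles $(h_p;L_p;R_p)$ and $(h_c;L_c;R_c)$, and define $$k^\star:=\min\{k\ge h_c:(a_k^{(R_p)},b_k^{(R_p)})\ne(1,1)\}.$$ Then $\mathcal T_p\oplus\mathcal T_c$ has profile $(h;L;R)$ given as follows. (i) HS number: $$h=\begin{cases}h_c,&h_c>h_p,\\ h_p+1,&h_c\le h_p\text{ and }k^\star=h_p+1,\\ h_p,&\text{otherwise.}\end{cases}$$ (ii) Right profile. If $h_c>h_p$, then $(a_k^{(R)},b_k^{(R)})=(a_k^{(R_c)},b_k^{(R_c)})$ for $k\le h_c$, and $m^{(R)}=1$. If $h_c\le h_p$, then $$(a_k^{(R)},b_k^{(R)})=\begin{cases}(a_k^{(R_c)},b_k^{(R_c)}),&k\le h_c,\\(1,0),&h_c<k\le k^\star,\\(a_k^{(R_p)},b_k^{(R_p)}),&k^\star<k\le h_p,\end{cases}\qquad m^{(R)}=\begin{cases}1,&k^\star=h_p,\\ m^{(R_p)},&\text{otherwise,}\end{cases}$$ where in the case $k^\star=h_c$ the middle range is empty. (iii) Left profile. For all $k<h_p$, $(a_k^{(L)},b_k^{(L)})=(a_k^{(L_p)},b_k^{(L_p)})$. At the top level: - If $h_c>h_p$: $(a_{h_c}^{(L)},b_{h_c}^{(L)})=(1,1)$, $m^{(L)}=0$, and $(a_{h_p}^{(L)},b_{h_p}^{(L)})$ equals $(a_{h_p}^{(L_p)},b_{h_p}^{(L_p)})$ if $m^{(L_p)}=1$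 and equals $(0,0)$ if $m^{(L_p)}=0$. - If $h_c\le h_p$ and $k^\star=h_p+1$: $(a_{h_p+1}^{(L)},b_{h_p+1}^{(L)})=(1,m^{(R)})$, $m^{(L)}=0$, and $(a_{h_p}^{(L)},b_{h_p}^{(L)})$ equals $(a_{h_p}^{(L_p)},b_{h_p}^{(L_p)})$ if $m^{(L_p)}=1$ and equals $(0,0)$ if $m^{(L_p)}=0$. - If $h_c\le h_p$ and $k^\star=h_p$: $(a_{h_p}^{(L)},b_{h_p}^{(L)})=(1,1)$ and $m^{(L)}=0$. - If $h_c\le h_p$ and $k^\star<h_p$: $(a_{h_p}^{(L)},b_{h_p}^{(L)})=(a_{h_p}^{(L_p)},b_{h_p}^{(L_p)})$ and $m^{(L)}=m^{(L_p)}$. The profile of $\mathcal T_p\ominus\mathcal T_c$ is obtained via $\mathcal T_p\ominus\mathcal T_c=(\mathcal T_p^R\oplus\mathcal T_c^R)^R$.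
   Context: A rooted binary tree is a finite nonempty rooted tree in which each node has at most one left child and at most one right child. The Horton--Strahler (HS) number of a node $v$ is: $0$ if $v$ has no children; the HS number of the child if $v$ has exactly one child; and $\max(\operatorname{HS}(v_\ell),\operatorname{HS}(v_r))+\mathbf 1_{\{\operatorname{HS}(v_\ell)=\operatorname{HS}(v_r)\}}$ if $v$ has children $v_\ell,v_r$. $\operatorname{HS}(\mathcal T)$ is the HS number of the root of $\mathcal T$. The top right (resp. top left) edge of a rooted binary tree is the path of nodes that starts at the root and repeatedly moves to the right (resp. left) child until the current node has no right (resp. left) child. $\mathcal T_p\oplus\mathcal T_c$ is obtained by making the root of $\mathcal T_c$ the right child of the last node of the top right edge of $\mathcal T_p$; $\mathcal T_p\ominus\mathcal T_c$ is obtained by making the root of $\mathcal T_c$ the left child of the last node of the top left edge of $\mathcal T_p$. $\mathcal T^R$ denotes the mirror image of $\mathcal T$ (left and right children swapped at every node); reflection preserves the HS number and swaps the left and right edge profiles, so that if $\mathcal T$ has profile $(h;L;R)$ then $\mathcal T^R$ has profile $(h;R;L)$. Profiles: the HS profile of $\mathcal T$ is $(\operatorname{HS}(\mathcal T);L;R)$, where $L$ and $R$ are the edge profiles of the top left and top right edge. An edge profile $E=(m^{(E)},(a_k^{(E)},b_k^{(E)})_{k\ge0})$ consists of bits: $m^{(E)}=1$ if the edge contains at least two nodes whose HS number equals the maximal value $\operatorname{HS}(\mathcal T)$, and $m^{(E)}=0$ otherwise; $a_k^{(E)}=1$ if the edge contains a node with HS number $k$, and $0$ otherwise; $b_k^{(E)}=1$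 if $a_k^{(E)}=1$ and the node of maximal depth on the edge among those with HS number $k$ has a child off the edge with HS number $k$, and $b_k^{(E)}=0$ otherwise. In particular $(a_k,b_k)=(0,0)$ for $k>\operatorname{HS}(\mathcal T)$. *)

(* Defs.v *)
From mathcomp Require Import all_boot.

Set Implicit Arguments.
Unset Strict Implicit.
Unset Printing Implicit Defensive.

(* [Node l r]: the left child comes first.  There is no empty tree. *)
Inductive btree : Type := Node of option btree & option btree.

Definition lchild (t : btree) : option btree := let: Node l _ := t in l.
Definition rchild (t : btree) : option btree := let: Node _ r := t in r.

(* A node is represented by the subtree rooted at it, so [HS] is both the
   Horton-Strahler number of a tree and that of a node. *)
Fixpoint HS (t : btree) : nat :=
  match t with
  | Node None None => 0
  | Node (Some l) None => HS l
  | Node None (Some r) => HS r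
  | Node (Some l) (Some r) => maxn (HS l) (HS r) + (HS l == HS r)
  end.

(* The nodes of the top left and top right edges, in order of increasing
   depth. *)
Fixpoint ledge (t : btree) : seq btree :=
  t :: (if t is Node (Some l) _ then ledge l else [::]).
Fixpoint redge (t : btree) : seq btree :=
  t :: (if t is Node _ (Some r) then redge r else [::]).

Fixpoint oplus (tp tc : btree) : btree :=
  match tp with
  | Node l None => Node l (Some tc)
  | Node l (Some r) => Node l (Some (oplus r tc))
  end.

Fixpoint ominus (tp tc : btree) : btree :=
  match tp with
  | Node None r => Node (Some tc) r
  | Node (Some l) r => Node (Some (ominus l tc)) r
  end.

Fixpoint mirror (t : btree) : btree :=
  let: Node l r := t in
  Node (if r is Some r' then Some (mirror r') else None)
       (if l is Some l' then Some (mirror l') else None).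

Record edge_profile : Type := EdgeProfile {
  m_bit : bool;
  ab_bits : nat -> bool * bool
}.

Record hs_profile : Type := HSProfile {
  hs_number : nat;
  left_profile : edge_profile;
  right_profile : edge_profile
}.

Definition nodes_of_HS (k : nat) (e : seq btree) : seq btree :=
  [seq v <- e | HS v == k].

Definition a_bit (e : seq btree) (k : nat) : bool := has (fun v => HS v == k) e.

(* [off v] is the child of the edge node [v] that lies off the edge.  The
   default value [t] of [last] is irrelevant, since it is reached only when
   [a_bit e k] is false. *)
Definition b_bit (off : btree -> option btree) (t : btree) (e : seq btree)
    (k : nat) : bool :=
  a_bit e k && (omap HS (off (last t (nodes_of_HS k e))) == Some k).

Definition profile_of_edge (off : btree -> option btree) (t : btree)
    (e : seq btree) : edge_profile :=
  EdgeProfile (2 <= size (nodes_of_HS (HS t) e))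
              (fun k => (a_bit e k, b_bit off t e k)).

(* The last node of the top right edge has no right child, so the off-edge
   child of any node of that edge is its left child; dually on the left. *)
Definition profile (t : btree) : hs_profile :=
  HSProfile (HS t) (profile_of_edge rchild t (ledge t))
                   (profile_of_edge lchild t (redge t)).

Definition swap_profile (p : hs_profile) : hs_profile :=
  HSProfile (hs_number p) (right_profile p) (left_profile p).

Lemma HS_redge (t : btree) : all (fun v => HS v <= HS t) (redge t).
Proof.
move: t; fix IH 1 => -[l [r|]]; last by rewrite /= leqnn.
have le_r : HS r <= HS (Node l (Some r)).
  by case: l => [l|] //=; rewrite -addnC; apply: leq_trans (leq_maxr _ _) (leq_addl _ _).
rewrite [redge _]/= [all _ _]/= leqnn; apply: sub_all (IH r) => v le_v.
exact: leq_trans le_v le_r.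
Qed.

Lemma kstar_exists (tp tc : btree) :
  exists k, (HS tc <= k) &&
            (ab_bits (right_profile (profile tp)) k != (true, true)).
Proof.
exists (maxn (HS tc) (HS tp).+1); rewrite leq_maxl /= xpair_eqE negb_and.
apply/orP; left; rewrite eqb_id -all_predC.
apply: sub_all (HS_redge tp) => v le_v /=.
by rewrite neq_ltn (leq_ltn_trans le_v) // leq_maxr.
Qed.

Definition kstar (tp tc : btree) : nat := ex_minn (kstar_exists tp tc).

(* Main.v *)
Require Import Defs.
From mathcomp Require Import all_boot.
From mathcomp Require Import zify.
From Stdlib Require Import FunctionalExtensionality.

(** Climb the top right edge of [Tp] from its bottom, as in binary addition.
    Passing a node [t], the number [k*] behaves like a carry: it changes only
    when it equals both [HS t] and the HS number of the left child of [t], and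
    then it increases by one.  By induction [Tp (+) Tc] has HS number
    [max (HS Tp) k*], and its right bits are those of [Tc] up to [HS Tc],
    [(1,0)] up to [k*], and those of [Tp] beyond; this includes the case
    [HS Tc > HS Tp], where [k* = HS Tc].  On the left edge only the root
    changes.  Since HS numbers do not increase down an edge, the bit [m] only
    compares the root with its child on the edge. *)

Notation rbits t := (ab_bits (right_profile (profile t))).
Notation lbits t := (ab_bits (left_profile (profile t))).

(** * Structural induction and reflection *)

Lemma btree_rec_ind (P : btree -> Prop) :
    (forall l r, oapp P True l -> oapp P True r -> P (Node l r)) ->
  forall t, P t.
Proof.
move=> PNode; fix IH 1 => -[l r].
by apply: PNode; [case: l | case: r] => //=.
Qed.

Lemma HS_nodeC l r : HS (Node l r) = HS (Node r l).
Proof. by case: l r => [l|] [r|] //=; rewrite maxnC eq_sym. Qed.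

Lemma leq_HS_rchild l r : HS r <= HS (Node l (Some r)).
Proof. by case: l => [l|] //=; lia. Qed.

Lemma leq_HS_lchild l r : HS l <= HS (Node (Some l) r).
Proof. by rewrite HS_nodeC leq_HS_rchild. Qed.

Lemma mirror_node l r : mirror (Node l r) = Node (omap mirror r) (omap mirror l).
Proof. by case: l r => [l|] [r|]. Qed.

Lemma mirrorK : involutive mirror.
Proof.
elim/btree_rec_ind=> l r IHl IHr; rewrite !mirror_node.
by case: l r IHl IHr => [l|] [r|] /= IHl IHr; rewrite ?IHl ?IHr.
Qed.

Lemma HS_mirror t : HS (mirror t) = HS t.
Proof.
elim/btree_rec_ind: t => l r IHl IHr; rewrite mirror_node HS_nodeC.
by case: l r IHl IHr => [l|] [r|] /= IHl IHr; rewrite ?IHl ?IHr.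
Qed.

Lemma rchild_mirror t : rchild (mirror t) = omap mirror (lchild t).
Proof. by case: t => [[l|] r]. Qed.

Lemma lchild_mirror t : lchild (mirror t) = omap mirror (rchild t).
Proof. by case: t => l [r|]. Qed.

Lemma ledge_mirror t : ledge (mirror t) = map mirror (redge t).
Proof.
by elim/btree_rec_ind: t => l [r|] _ //= ->.
Qed.

Lemma nodes_of_HS_mirror k e :
  nodes_of_HS k (map mirror e) = map mirror (nodes_of_HS k e).
Proof.
by rewrite /nodes_of_HS filter_map; congr map; apply: eq_filter => v /=;
  rewrite HS_mirror.
Qed.

Lemma profile_of_edge_mirror off off' t e :
    (forall v, off' (mirror v) = omap mirror (off v)) ->
  profile_of_edge off' (mirror t) (map mirror e) = profile_of_edge off t e.
Proof.
move=> offE; rewrite /profile_of_edge nodes_of_HS_mirror size_map HS_mirror.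
congr EdgeProfile; apply: functional_extensionality => k.
rewrite /b_bit nodes_of_HS_mirror last_map offE.
have -> : a_bit (map mirror e) k = a_bit e k.
  by rewrite /a_bit has_map; apply: eq_has => v /=; rewrite HS_mirror.
by case: (off _) => //= v; rewrite HS_mirror.
Qed.

Lemma profile_mirror t : profile (mirror t) = swap_profile (profile t).
Proof.
rewrite /profile /swap_profile HS_mirror ledge_mirror /=; congr HSProfile.
  exact: profile_of_edge_mirror rchild_mirror.
(* Applying the injective [map mirror] to both sides and cancelling double reflections reduces this
   to [ledge_mirror]. *)
have -> : redge (mirror t) = map mirror (ledge t).
  by apply: (inj_map (inv_inj mirrorK)); rewrite -ledge_mirror !mirrorK
    mapK //; exact: mirrorK.
exact: profile_of_edge_mirror lchild_mirror.
Qed.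

Lemma ominus_mirror tp tc :
  ominus tp tc = mirror (oplus (mirror tp) (mirror tc)).
Proof.
elim/btree_rec_ind: tp => -[l|] [r|] IHl _ /=; rewrite ?mirrorK ?IHl //.
Qed.

(** * Profile bits computed from the root *)

Lemma rbits_HS t : (rbits t (HS t)).1.
Proof. by case: t => l [r|]; rewrite /= /a_bit /= eqxx. Qed.

Lemma rbits_le_HS t k : (rbits t k).1 -> k <= HS t.
Proof.
move=> /= t_k; rewrite leqNgt; apply/negP => lt_tk; move: t_k.
apply/negP; rewrite /a_bit -all_predC; apply: sub_all (HS_redge t) => v le_vt /=.
by rewrite neq_ltn (leq_ltn_trans le_vt).
Qed.

Lemma rbits_gt_HS t k : HS t < k -> rbits t k = (false, false).
Proof.
move=> lt_tk; have : ~~ (rbits t k).1.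
  by apply/negP => /rbits_le_HS; rewrite leqNgt lt_tk.
by rewrite /= /b_bit => /negPf ->.
Qed.

Definition obits (r : option btree) (k : nat) : bool * bool :=
  oapp (fun r => rbits r k) (false, false) r.

Lemma redge_node l r : redge (Node l r) = Node l r :: oapp redge [::] r.
Proof. by case: r. Qed.

(** At each level the deepest node decides, so the root matters only where the edge below it has no
    node of that HS number. *)
Lemma rbits_node l r k :
  rbits (Node l r) k =
    if (obits r k).1 then obits r k
    else (HS (Node l r) == k, (HS (Node l r) == k) && (omap HS l == Some k)).
Proof.
have offE : lchild (Node l r) = l by [].
rewrite {1}/profile /profile_of_edge /right_profile /ab_bits redge_node.
move: (Node l r) offE => t offE.
rewrite /b_bit /a_bit /nodes_of_HS /=.
case: r => [r|] /=; last by rewrite orbF; case: eqP => //= _; rewrite offE.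
rewrite /b_bit /a_bit /nodes_of_HS.
(* A nonempty filtered tail fixes [last] whatever its default; an empty one leaves the root as the
   only candidate. *)
rewrite has_count -size_filter; case: [seq v <- redge r | _] => [|v e] /=.
  by rewrite orbF; case: eqP => //= _; rewrite offE.
by case: (HS t == k).
Qed.

Lemma rmax_node l r :
  m_bit (right_profile (profile (Node l r))) =
    (omap HS r == Some (HS (Node l r))).
Proof.
have: oapp HS 0 r <= HS (Node l r) by case: r => // r; apply: leq_HS_rchild.
rewrite {1}/profile /profile_of_edge /right_profile /m_bit redge_node.
move: (Node l r) => t; rewrite /nodes_of_HS /= eqxx /= ltnS size_filter -has_count.
case: r => //= r le_rt; apply/idP/eqP => [t_r|[<-]]; last exact: rbits_HS.
by congr Some; apply/eqP; rewrite eqn_leq le_rt (@rbits_le_HS r).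
Qed.

Lemma lbits_node l r k :
  lbits (Node l r) k =
    if (oapp (fun l => lbits l k) (false, false) l).1
    then oapp (fun l => lbits l k) (false, false) l
    else (HS (Node l r) == k, (HS (Node l r) == k) && (omap HS r == Some k)).
Proof.
(* Left bits are right bits of the mirror image, so the recursion transfers from [rbits_node]. *)
have lE t : lbits t = rbits (mirror t) by rewrite profile_mirror.
rewrite lE mirror_node rbits_node -mirror_node HS_mirror /obits.
have -> : omap HS (omap mirror r) = omap HS r by case: r => //= r; rewrite HS_mirror.
have -> // : oapp (fun l => rbits l k) (false, false) (omap mirror l) =
             oapp (fun l => lbits l k) (false, false) l.
by case: l => // l; rewrite -[RHS]/(lbits l k) lE.
Qed.

Lemma lmax_node l r :
  m_bit (left_profile (profile (Node l r))) =
    (omap HS l == Some (HS (Node l r))).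
Proof.
have -> : left_profile (profile (Node l r)) =
          right_profile (profile (mirror (Node l r))) by rewrite profile_mirror.
rewrite mirror_node rmax_node -mirror_node HS_mirror.
by case: l => //= l; rewrite HS_mirror.
Qed.

Lemma lbits_le_HS t k : (lbits t k).1 -> k <= HS t.
Proof.
by have := @rbits_le_HS (mirror t) k; rewrite profile_mirror HS_mirror.
Qed.

Lemma lbits_HS t : (lbits t (HS t)).1.
Proof. by have := rbits_HS (mirror t); rewrite profile_mirror HS_mirror. Qed.

(** * The carry [kstar] and its recursion along the edge *)

Lemma kstar_eq tp tc k :
    HS tc <= k -> rbits tp k != (true, true) ->
    (forall j, HS tc <= j < k -> rbits tp j = (true, true)) ->
  kstar tp tc = k.
Proof.
move=> le_ck bits_k lt_k; rewrite /kstar.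
case: ex_minnP => m /andP[le_cm bits_m] min_m.
have le_mk : m <= k by rewrite min_m // le_ck.
apply/eqP; rewrite eqn_leq le_mk leqNgt; apply/negP => lt_mk.
by rewrite lt_k ?eqxx ?le_cm in bits_m.
Qed.

Lemma kstar_ge tp tc : HS tc <= kstar tp tc.
Proof. by rewrite /kstar; case: ex_minnP => m /andP[]. Qed.

Lemma kstar_neq tp tc : rbits tp (kstar tp tc) != (true, true).
Proof. by rewrite /kstar; case: ex_minnP => m /andP[]. Qed.

Lemma kstar_lt tp tc j :
  HS tc <= j < kstar tp tc -> rbits tp j = (true, true).
Proof.
rewrite /kstar; case: ex_minnP => m _ min_m /andP[le_cj lt_jm].
by apply/eqP/negPn/negP => bits_j; have := min_m j; rewrite le_cj bits_j; lia.
Qed.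

Lemma kstar_le tp tc : kstar tp tc <= maxn (HS tc) (HS tp).+1.
Proof.
(* Otherwise [(true, true)] would occur at a level above [HS tp], where the edge has no node. *)
rewrite leqNgt; apply/negP => lt_max.
have := @kstar_lt tp tc (maxn (HS tc) (HS tp).+1); rewrite leq_maxl lt_max.
by move=> /(_ isT) E; have := @rbits_le_HS tp _ (congr1 fst E); lia.
Qed.

(** An absent right subtree counts as having all bits [(false, false)], so its carry stops at once,
    at [HS tc]. *)
Definition okstar (r : option btree) (tc : btree) : nat :=
  oapp (fun r => kstar r tc) (HS tc) r.

(** The root can alter the bits only at its own level. If the carry from below stops there and the
    left child has the same HS number, the run of [(true, true)] grows by exactly this level, since
    the bits vanish one level higher. Otherwise the old stopping place remains. *)
Lemma kstar_node l r tc :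
  kstar (Node l r) tc =
    if (okstar r tc == HS (Node l r)) && (omap HS l == Some (HS (Node l r)))
    then (okstar r tc).+1 else okstar r tc.
Proof.
set t := Node l r; set x := okstar r tc.
have le_cx : HS tc <= x by rewrite /x; case: (r) => //= r'; exact: kstar_ge.
have bits_x : obits r x != (true, true).
  by rewrite /x; case: (r) => //= r'; exact: kstar_neq.
have lt_x j : HS tc <= j < x -> obits r j = (true, true).
  by rewrite /x; case: (r) => [r' /kstar_lt|] //=; lia.
have le_r k : (obits r k).1 -> k <= HS t.
  rewrite /t; case: (r) => //= r' /rbits_le_HS h.
  exact: leq_trans h (leq_HS_rchild _ _).
have lt_x' j : HS tc <= j < x -> rbits t j = (true, true).
  by move=> /lt_x E; rewrite rbits_node E.
(* If the left child has the HS number of the root, the right child has a strictly smaller one,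
   since a tie would have raised the root; so the edge below never reaches that level. *)
have lt_l k : omap HS l == Some (HS t) -> (obits r k).1 -> k < HS t.
  rewrite /t; case: (l) (r) => [l'|] [r'|] //= /eqP[El] /rbits_le_HS.
  by move: El; lia.
case: ifP => [/andP[/eqP x_t l_t]|cond].
  apply: kstar_eq => [|| j]; first by lia.
    rewrite rbits_node ifN ?xpair_eqE; last by apply/negP => /le_r; lia.
    by rewrite -/t x_t; apply/negP => /andP[/eqP]; lia.
  rewrite ltnS [j <= _]leq_eqVlt => /andP[le_cj /orP[/eqP->|lt_jx]]; last first.
    by rewrite lt_x' ?le_cj.
  rewrite rbits_node ifN; last by apply/negP => /(lt_l _ l_t); lia.
  by rewrite -/t x_t eqxx l_t.
apply: kstar_eq => //; rewrite rbits_node -/t.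
case: ifP => // _; rewrite xpair_eqE !eqb_id.
by apply/negP => /andP[/eqP t_x /andP[_ l_x]]; rewrite t_x l_x eqxx in cond.
Qed.

(** * HS number and right profile of [oplus] *)

Definition ooplus (r : option btree) (tc : btree) : btree :=
  oapp (fun r => oplus r tc) tc r.

Lemma oplus_node l r tc : oplus (Node l r) tc = Node l (Some (ooplus r tc)).
Proof. by case: r. Qed.

(** A new tie between the children of the root arises exactly when the carry moves past it, and each
    raises its value by one. *)
Lemma HS_oplus tp tc : HS (oplus tp tc) = maxn (HS tp) (kstar tp tc).
Proof.
elim/btree_rec_ind: tp => l r _ IHr; rewrite oplus_node kstar_node.
have {IHr} : HS (ooplus r tc) = maxn (oapp HS 0 r) (okstar r tc).
  by case: r IHr => //= _; rewrite max0n.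
case: l r => [l|] [r|] /= ->; rewrite ?max0n ?andbF // ?(inj_eq Some_inj);
  case: ifP; lia.
Qed.

Lemma rbits_oplus tp tc k :
  rbits (oplus tp tc) k =
    if k <= HS tc then rbits tc k
    else if k <= kstar tp tc then (true, false) else rbits tp k.
Proof.
elim/btree_rec_ind: tp => l r _ IHr.
have {IHr} obitsE : obits (Some (ooplus r tc)) k =
    if k <= HS tc then rbits tc k
    else if k <= okstar r tc then (true, false) else obits r k.
  (* Without a right child the new edge below is that of [tc]. Its bits vanish above [HS tc], and
     the middle range is empty. *)
  case: r IHr => [//|_]; rewrite -[LHS]/(rbits tc k).
  by case: (leqP k (HS tc)) => // lt_ck; rewrite rbits_gt_HS // if_same.
have := HS_oplus (Node l r) tc; have := kstar_ge (Node l r) tc.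
have le_r : (obits r k).1 -> k <= HS (Node l r).
  case: (r) => //= r' /rbits_le_HS h; exact: leq_trans h (leq_HS_rchild _ _).
have lt_r : omap HS l == Some (HS (Node l r)) -> (obits r k).1 ->
    k < HS (Node l r).
  case: (l) (r) => [l'|] [r'|] //= /eqP[El] /rbits_le_HS.
  by move: El; lia.
rewrite oplus_node !rbits_node obitsE => ge_ks hE.
rewrite hE; move: ge_ks; rewrite kstar_node.
move: (HS (Node l r)) le_r lt_r => t le_r lt_r.
case: (leqP k (HS tc)) => [le_kc ge_ks|lt_ck ge_ks].
  case: ifP => // /negbT bits_k.
  (* The root of [tc] occupies level [HS tc], so a missing level lies strictly below it, hence below
     the new root. *)
  have lt_kc : k < HS tc.
    by rewrite ltn_neqAle le_kc andbT; apply: contraNneq bits_k => ->; exact: rbits_HS.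
  rewrite (_ : _ == k = false); last by apply/eqP; lia.
  by move: bits_k; rewrite /= /b_bit => /negPf ->.
move: (okstar r tc) {obitsE ge_ks hE} => x.
case: (boolP ((x == t) && (omap HS l == Some t))) => [/andP[/eqP -> /eqP l_t]|_];
  last first.
  case: (leqP k x) => //= lt_xk; case: ifP => // _.
  by rewrite (_ : (maxn t x == k) = (t == k)) //; lia.
(* The carry moves: the new root is at level [t.+1] while its left child has HS number [t], which
   gives [(true, false)] there. *)
rewrite l_t eqxx in lt_r; rewrite l_t (inj_eq Some_inj).
case: (leqP k t) => [le_kt|lt_tk] /=; first by rewrite leqW.
have -> : (obits r k).1 = false by apply/negP => /(lt_r isT); lia.
case: ifP => le_k; congr pair; lia.
Qed.

Lemma rmax_oplus tp tc :
  m_bit (right_profile (profile (oplus tp tc))) =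
    [|| HS tp < HS tc, kstar tp tc == HS tp | m_bit (right_profile (profile tp))].
Proof.
case: tp => l r; rewrite oplus_node !rmax_node -oplus_node HS_oplus.
(* When [HS tc <= HS tp], this bound lets the right child reach [(HS tp).+1] only if its HS number
   was [HS tp] before. *)
have le_x : okstar r tc <= maxn (HS tc) (oapp (fun r => (HS r).+1) 0 r).
  by case: (r) => [r'|] /=; [exact: kstar_le | rewrite maxn0].
have ge_x : HS tc <= okstar r tc by case: (r) => // r'; exact: kstar_ge.
have -> : omap HS (Some (ooplus r tc)) = Some (maxn (oapp HS 0 r) (okstar r tc)).
  by case: (r) => [r'|] /=; rewrite ?HS_oplus ?max0n.
rewrite kstar_node (inj_eq Some_inj).
move: (okstar r tc) le_x ge_x => x.
by case: l r => [l|] [r|] /=;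
  rewrite -?[None == _]/false ?andbF ?(inj_eq Some_inj); try case: ifP; lia.
Qed.

(** * Left profile of [oplus] *)

Lemma kstar_neq_HS tp tc :
  m_bit (left_profile (profile tp)) -> kstar tp tc != HS tp.
Proof.
(* The left child has the HS number of the root, so a carry reaching that value moves past it. *)
case: tp => l r; rewrite lmax_node kstar_node => ->; rewrite andbT.
by case: ifP => [/eqP -> | /negbT //]; rewrite neq_ltn ltnSn orbT.
Qed.

Lemma lmax_oplus tp tc :
  m_bit (left_profile (profile (oplus tp tc))) =
    (kstar tp tc < HS tp) && m_bit (left_profile (profile tp)).
Proof.
have := @kstar_neq_HS tp tc; have := HS_oplus tp tc.
case: tp => l r; rewrite oplus_node !lmax_node => ->.
have : oapp HS 0 l <= HS (Node l r) by case: l => // l; apply: leq_HS_lchild.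
move: (HS (Node l r)) (kstar _ _) => t ks.
case: l => [l|] /=; last by rewrite andbF.
by rewrite !(inj_eq Some_inj); lia.
Qed.

(** On the left edge the off-edge child of the root is its right child; whether the two share their
    HS number is what [m] records on the right edge. If the root leaves level [HS tp], only the left
    child can keep that level occupied, hence the test of the old left [m]. *)
Lemma lbits_oplus tp tc k :
  lbits (oplus tp tc) k =
    if (k < HS tp) || (k == HS tp) && (kstar tp tc < HS tp) then lbits tp k
    else if k == maxn (HS tp) (kstar tp tc)
      then (true, m_bit (right_profile (profile (oplus tp tc))))
    else if (k == HS tp) && m_bit (left_profile (profile tp))
      then lbits tp k
    else (false, false).
Proof.
have neq_ks := @kstar_neq_HS tp tc; have hE := HS_oplus tp tc.
have rE := rmax_oplus tp tc; have ge_ks := kstar_ge tp tc.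
case: tp neq_ks hE rE ge_ks => l r; rewrite oplus_node !rmax_node !lmax_node.
rewrite !lbits_node.
have le_l : oapp HS 0 l <= HS (Node l r) by case: l => // l; apply: leq_HS_lchild.
move=> neq_ks -> + ge_ks.
move: (HS (Node l r)) (kstar _ _) le_l neq_ks ge_ks => t ks le_l neq_ks ge_ks rE.
rewrite rE.
set ol := oapp _ _ l.
have ol_le : ol.1 -> k <= t.
  by rewrite /ol; case: (l) le_l => //= l' le_l /(@lbits_le_HS l'); lia.
have ol_HS : k = t -> ol.1 = (omap HS l == Some t).
  rewrite /ol => ->; case: (l) le_l => //= l' le_l.
  apply/idP/eqP => [/(@lbits_le_HS l') h|[<-]]; last exact: lbits_HS.
  by congr Some; lia.
have [lt_kt|lt_tk|k_t] := ltngtP k t.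
- by rewrite [maxn _ _ == k]gtn_eqF ?leq_max ?lt_kt.
- have -> : ol.1 = false by apply/negP => /ol_le; rewrite leqNgt lt_tk.
  by rewrite eq_sym; case: eqP => [->|_] //; rewrite rE.
rewrite k_t in ol_HS *; rewrite ol_HS //.
have [lt_kst|lt_tks|ks_t] := ltngtP ks t.
(* The root keeps its HS number, and by [rE] the comparison with its right child is unchanged. *)
- rewrite /= eqxx /=; move: rE; rewrite (maxn_idPl (ltnW lt_kst)) => ->.
  by rewrite (ltn_eqF lt_kst) ltnNge (leq_trans ge_ks (ltnW lt_kst)).
- by rewrite (ltn_eqF lt_tks) (gtn_eqF lt_tks) /=; case: ifP.
(* The old left [m] is 0, so on this edge only the root has level [t], and its right child now has
   HS number [t] too. *)
- rewrite ifN; last by apply: contraTN isT => /neq_ks; rewrite ks_t eqxx.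
  by move: rE; rewrite ks_t maxnn !eqxx => ->.
Qed.

(** * Assembly of the cases *)

Lemma profile_inv t h L R :
    profile t = HSProfile h L R ->
  [/\ h = HS t, L = left_profile (profile t) & R = right_profile (profile t)].
Proof. by move=> E; rewrite -[HS t]/(hs_number (profile t)) E. Qed.

Theorem proposition2 (Tp Tc : btree) (hp hc h : nat)
    (Lp Rp Lc Rc L R : edge_profile)
    (profile_p : profile Tp = HSProfile hp Lp Rp)
    (profile_c : profile Tc = HSProfile hc Lc Rc)
    (profile_pc : profile (oplus Tp Tc) = HSProfile h L R) :
  let ks := kstar Tp Tc in
  (* HS number *)
  (h = if hp < hc then hc else if ks == hp.+1 then hp.+1 else hp)
  /\
  (* right profile *)
  ((hp < hc ->
      (forall k, k <= hc -> ab_bits R k = ab_bits Rc k) /\ m_bit R = true)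
   /\
   (hc <= hp ->
      (forall k, k <= hc -> ab_bits R k = ab_bits Rc k) /\
      (forall k, hc < k <= ks -> ab_bits R k = (true, false)) /\
      (forall k, ks < k <= hp -> ab_bits R k = ab_bits Rp k) /\
      m_bit R = (if ks == hp then true else m_bit Rp)))
  /\
  (* left profile *)
  ((forall k, k < hp -> ab_bits L k = ab_bits Lp k)
   /\
   (hp < hc ->
      ab_bits L hc = (true, true) /\ m_bit L = false /\
      ab_bits L hp = (if m_bit Lp then ab_bits Lp hp else (false, false)))
   /\
   (hc <= hp -> ks = hp.+1 ->
      ab_bits L hp.+1 = (true, m_bit R) /\ m_bit L = false /\
      ab_bits L hp = (if m_bit Lp then ab_bits Lp hp else (false, false)))
   /\
   (hc <= hp -> ks = hp ->
      ab_bits L hp = (true, true) /\ m_bit L = false)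
   /\
   (hc <= hp -> ks < hp ->
      ab_bits L hp = ab_bits Lp hp /\ m_bit L = m_bit Lp))
  /\
  (* the other operation, by reflection *)
  (ominus Tp Tc = mirror (oplus (mirror Tp) (mirror Tc)) /\
   profile (ominus Tp Tc) =
     swap_profile (profile (oplus (mirror Tp) (mirror Tc)))).
Proof.
have [-> -> ->] := profile_inv _ _ _ _ profile_p.
have [-> _ ->] := profile_inv _ _ _ _ profile_c.
have [-> -> ->] := profile_inv _ _ _ _ profile_pc.
move=> {profile_p profile_c profile_pc} ks.
have ge_ks := kstar_ge Tp Tc; have le_ks := kstar_le Tp Tc.
rewrite -/ks in ge_ks le_ks.
split; first by rewrite HS_oplus -/ks; case: ifP; try case: ifP; lia.
split.
  split=> [lt_pc|le_cp].
    split=> [k le_kc|]; first by rewrite rbits_oplus le_kc.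
    by rewrite rmax_oplus lt_pc.
  split=> [k le_kc|]; first by rewrite rbits_oplus le_kc.
  split=> [k /andP[lt_ck le_k]|].
    by rewrite rbits_oplus leqNgt lt_ck -/ks le_k.
  split=> [k /andP[lt_k le_kp]|]; last by rewrite rmax_oplus ltnNge le_cp.
  by rewrite rbits_oplus -/ks !ifN // -ltnNge; lia.
split; last first.
  by split; rewrite ominus_mirror // profile_mirror.
split=> [k lt_kp|]; first by rewrite lbits_oplus lt_kp.
split=> [lt_pc|].
  (* Both bounds on [ks] collapse to [HS Tc], because [(HS Tp).+1 <= HS Tc]. *)
  have ks_c : ks = HS Tc by lia.
  rewrite !lbits_oplus lmax_oplus rmax_oplus -/ks ks_c lt_pc.
  by rewrite ltnn eqxx (maxn_idPr (ltnW lt_pc)) eqxx (ltn_eqF lt_pc) (gtn_eqF lt_pc)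
    !ltnNge (ltnW lt_pc).
split=> [le_cp ks_p|].
  rewrite !lbits_oplus lmax_oplus -/ks ks_p.
  by rewrite !ltnNge !leqnSn !leqnn eqxx /= (maxn_idPr (leqnSn _))
    eqxx (gtn_eqF (ltnSn _)) (ltn_eqF (ltnSn _)).
split=> [le_cp ks_p|le_cp lt_ksp].
  by rewrite lbits_oplus lmax_oplus rmax_oplus -/ks ks_p ltnn eqxx maxnn eqxx orbT.
by rewrite lbits_oplus lmax_oplus -/ks lt_ksp eqxx orbT.
Qed.
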